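(* Let $A_1=P_1J_1P_1^{-1}$ with $J_1=\begin{pmatrix}-\alpha_1&\beta_1\\-\beta_1&-\alpha_1\end{pmatrix}$, $\alpha_1>0$, $\beta_1\ne0$, and $A_2=P_2J_2P_2^{-1}$ with $J_2=\mathrm{diag}(p_2,q_2)$, where either $0<p_2<q_2$ or $p_2\le0<q_2$; here $P_1,P_2$ are real invertible $2\times 2$ matrices chosen such that $M=P_2^{-1}P_1=\begin{pmatrix}a&b\\c&d\end{pmatrix}$ has determinant $1$. Given $\eta>0$, let $$\tau_{1,2}(\eta)=\left(\frac{q_2+p_2}{2\alpha_1}\right)\eta+\frac1{\alpha_1}\sinh^{-1}\left(\sqrt{(a^2+b^2)(c^2+d^2)}\,\sinh\left(\frac{q_2-p_2}{2}\,\eta\right)\right).$$ Then the switched system $\dot x(t)=A_{\sigma(t)}x(t)$ is stable for all $\sigma\in\mathcal S[\tau_{1,2}(\eta),\eta]$ and asymptotically stable for all $\sigma\in\mathcal S'[\tau_{1,2}(\eta),\eta]$.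
   Context: Planar switched system: $\dot x(t)=A_{\sigma(t)}x(t)$, $x(t)\in\mathbb R^2$ continuous in $t\ge0$, with $A_1,A_2$ real $2\times2$ matrices. A switching signal $\sigma:[0,\infty)\to\{1,2\}$ is right-continuous and piecewise constant with infinitely many discontinuities $0<d_1<d_2<\cdots$, $d_k\to\infty$; set $d_0=0$. For a signal with $\sigma(0)=1$ put $t_k=d_{2k-1}-d_{2k-2}$ (times spent in $A_1$) and $s_k=d_{2k}-d_{2k-1}$ (times spent in $A_2$), $k\ge1$. For $\tau,\eta>0$, $\mathcal S[\tau,\eta]$ is the set of signals with $\sigma(0)=1$, $t_k\ge\tau$ and $s_k\le\eta$ for all $k\in\mathbb N$; $\mathcal S'[\tau,\eta]$ is the set of $\sigma\in\mathcal S[\tau,\eta]$ for which the sequence $(t_k,s_k)_{k\ge1}$ does not converge to $(\tau,\eta)$. For a given signal $\sigma$, the system is stable if for every $\varepsilon'>0$ there is $\delta>0$ such that $\|x(0)\|<\delta$ implies $\|x(t)\|<\varepsilon'$ for all $t>0$; it is asymptotically stable if it is stable and $\|x(t)\|\to0$ as $t\to\infty$ for every $x(0)\in\mathbb R^2$. Norms are Euclidean. *)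

(* Defs.v *)
From HB Require Import structures.
From mathcomp Require Import all_boot all_order all_algebra.
From mathcomp Require Import all_classical all_reals all_analysis.
From mathcomp Require Import ring lra.

Set Implicit Arguments.
Unset Strict Implicit.
Unset Printing Implicit Defensive.

Import Order.TTheory GRing.Theory Num.Theory.
Import numFieldNormedType.Exports.
Local Open Scope classical_set_scope.
Local Open Scope ring_scope.

Definition mx2 (R : nzRingType) (a b c d : R) : 'M[R]_2 :=
  \matrix_(i < 2, j < 2) nth 0 (nth [::] [:: [:: a; b]; [:: c; d]] i) j.

Definition enorm (R : realType) (v : 'cV[R]_2) : R :=
  Num.sqrt (\sum_(i < 2) v i ord0 ^+ 2).

Definition sinh (R : realType) (x : R) : R := (expR x - expR (- x)) / 2.

(* The inverse of [sinh]; see [sinhK] and [arsinhK]. *)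
Definition arsinh (R : realType) (y : R) : R :=
  ln (y + Num.sqrt (y ^+ 2 + 1)).

Lemma arsinh_arg_gt0 (R : realType) (y : R) : 0 < y + Num.sqrt (y ^+ 2 + 1).
Proof.
have y2 : 0 <= y ^+ 2 by exact: sqr_ge0.
have h : `|y| < Num.sqrt (y ^+ 2 + 1) by rewrite -sqrtr_sqr ltr_sqrt; lra.
by move: h; rewrite ltr_norml => /andP[h _]; lra.
Qed.

Lemma arsinhK (R : realType) : cancel (@arsinh R) (@sinh R).
Proof.
move=> y; have := arsinh_arg_gt0 y.
rewrite /sinh /arsinh expRN => s0; rewrite lnK ?posrE //.
move: s0; set s := Num.sqrt _ => s0.
have s2 : s ^+ 2 = y ^+ 2 + 1 by rewrite sqr_sqrtr // addr_ge0 ?sqr_ge0.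
have -> : (y + s)^-1 = s - y.
  apply: (mulfI (lt0r_neq0 s0)); rewrite divff ?lt0r_neq0 //.
  by rewrite addrC [RHS]mulrC -subr_sqr s2 addrAC subrr add0r.
by field.
Qed.

Lemma sinhK (R : realType) : cancel (@sinh R) (@arsinh R).
Proof.
move=> x; have e1 : expR x * expR (- x) = 1 by rewrite -expRD subrr expR0.
have h : sinh x ^+ 2 + 1 = ((expR x + expR (- x)) / 2) ^+ 2.
  by rewrite /sinh -{2}e1; field.
rewrite /arsinh h sqrtr_sqr ger0_norm; last first.
  by rewrite divr_ge0 // addr_ge0 ?expR_ge0.
have -> : sinh x + (expR x + expR (- x)) / 2 = expR x by rewrite /sinh; field.
exact: expRK.
Qed.

Inductive mode := Mode1 | Mode2.

(* Signals and trajectories are total functions on [R]; only their values on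
   the half-line [0, +oo) are ever constrained or observed. *)
Definition switching_signal (R : realType) (sigma : R -> mode) (d : nat -> R)
    : Prop :=
  [/\ d 0%N = 0 /\ (forall k, d k < d k.+1),
      d @ \oo --> +oo,
      (forall t : R, 0 <= t -> \forall u \near t^'+, sigma u = sigma t),
      (forall k t u, d k < t < d k.+1 -> d k < u < d k.+1 -> sigma t = sigma u)
    & (forall k, ~ \forall u \near d k.+1, sigma u = sigma (d k.+1))].

(* Durations of the (k+1)-st stay in each mode, for signals starting in [Mode1]. *)
Definition time_in1 (R : realType) (d : nat -> R) (k : nat) : R :=
  d (2 * k).+1 - d (2 * k)%N.
Definition time_in2 (R : realType) (d : nat -> R) (k : nat) : R :=
  d (2 * k).+2 - d (2 * k).+1.

(* The sequence [d] is uniquely determined by [sigma]. *)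
Definition signal_class (R : realType) (tau eta : R) : set (R -> mode) :=
  [set sigma | exists d : nat -> R,
    [/\ switching_signal sigma d, sigma 0 = Mode1
      & forall k, tau <= time_in1 d k /\ time_in2 d k <= eta]].

Definition signal_class' (R : realType) (tau eta : R) : set (R -> mode) :=
  [set sigma | exists d : nat -> R,
    [/\ switching_signal sigma d, sigma 0 = Mode1,
        forall k, tau <= time_in1 d k /\ time_in2 d k <= eta
      & ~ ((fun k => (time_in1 d k, time_in2 d k)) @ \oo --> (tau, eta))]].

(* The equation is required at every positive time that is not a
   discontinuity of [sigma]. *)
Definition trajectory (R : realType) (A : mode -> 'M[R]_2) (sigma : R -> mode)
    (x : R -> 'cV[R]_2) : Prop :=
  {within [set t : R | 0 <= t], continuous x} /\
  forall t : R, 0 < t -> (\forall u \near t, sigma u = sigma t) ->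
    is_derive t 1 x (A (sigma t) *m x t).

Definition stable (R : realType) (A : mode -> 'M[R]_2) (sigma : R -> mode)
    : Prop :=
  forall eps : R, 0 < eps -> exists2 delta : R, 0 < delta &
    forall x, trajectory A sigma x -> enorm (x 0) < delta ->
      forall t : R, 0 < t -> enorm (x t) < eps.

Definition asymptotically_stable (R : realType) (A : mode -> 'M[R]_2)
    (sigma : R -> mode) : Prop :=
  stable A sigma /\
  forall x, trajectory A sigma x -> enorm (x t) @[t --> +oo] --> 0.

Definition switched (R : realType) (A1 A2 : 'M[R]_2) (m : mode) : 'M[R]_2 :=
  match m with Mode1 => A1 | Mode2 => A2 end.

Definition tau12 (R : realType) (alpha1 p2 q2 a b c d eta : R) : R :=
  (q2 + p2) / (2 * alpha1) * eta +
  alpha1^-1 * arsinh (Num.sqrt ((a ^+ 2 + b ^+ 2) * (c ^+ 2 + d ^+ 2)) *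
                      sinh ((q2 - p2) / 2 * eta)).

(* Main.v *)
Require Import Defs.
From HB Require Import structures.
From mathcomp Require Import all_boot all_order all_algebra.
From mathcomp Require Import all_classical all_reals all_analysis.
From mathcomp Require Import ring lra.

Import Order.TTheory GRing.Theory Num.Theory.
Import numFieldNormedType.Exports.
Local Open Scope classical_set_scope.
Local Open Scope ring_scope.

(** The squared length [V] of [y = P1^-1 x] serves as a Lyapunov function that is
observed at the beginning of each cycle, a cycle being a stay in the first mode
followed by a stay in the second.

In the first mode [V] decays exactly like [expR (- 2 alpha1 t)]
([focus_decay]). In the second mode the flow in the variable [y] is
[M^-1 diag (expR (p2 s), expR (q2 s)) M] with [M = P2^-1 P1], which is a scalar
times a matrix of determinant 1. The largest singular value of a matrix of
determinant 1 is determined by its Frobenius norm ([det1_singular_value]), and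
so over a stay of length [s] the function [V] is multiplied by at most
[expR (2 phi s)] ([node_growth]), where
  [phi s = (q2 + p2) / 2 * s + arsinh (k * sinh ((q2 - p2) / 2 * s))]
and [k^2 = (a^2 + b^2) (c^2 + d^2) = 1 + (a c + b d)^2 >= 1]. Hence
[tau12 = phi eta / alpha1] is exactly the time the first mode needs in order to
compensate the longest stay in the second.

Since [k >= 1], the slope of [phi] is at least [q2 > 0]
([growth_exponent_slope]). A cycle with stays [t >= tau] and [s <= eta] thus
multiplies [V] by at most [expR (- 2 r)] with
[r = alpha1 (t - tau) + q2 (eta - s) >= 0]. It follows that [V] never exceeds a
fixed multiple of its initial value, which is stability. Moreover, if [V] does
not tend to 0, then [r] tends to 0 along the cycles
([vanishing_of_contraction]), that is, the stays converge to [(tau, eta)]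
([contraction_exponent_cvg0]), which the smaller class of signals excludes. *)

(** * Squared Euclidean norm in the plane *)

Definition sqnorm {R : realType} (v : 'cV[R]_2) : R := \sum_i v i ord0 ^+ 2.

Lemma sqnormE {R : realType} (v : 'cV[R]_2) :
  sqnorm v = v ord0 ord0 ^+ 2 + v ord_max ord0 ^+ 2.
Proof.
rewrite /sqnorm !big_ord_recl big_ord0 addr0.
by do 2 f_equal; congr (v _ _); apply: val_inj.
Qed.

Lemma sqnorm_ge0 {R : realType} (v : 'cV[R]_2) : 0 <= sqnorm v.
Proof. by apply: sumr_ge0 => i _; exact: sqr_ge0. Qed.

Lemma mulmx2E {R : realType} (L : 'M[R]_2) (v : 'cV[R]_2) i :
  (L *m v) i ord0 = L i ord0 * v ord0 ord0 + L i ord_max * v ord_max ord0.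
Proof.
rewrite mxE !big_ord_recl big_ord0 addr0.
by do 2 f_equal; [congr (L _ _)|congr (v _ _)]; apply: val_inj.
Qed.

Lemma mx2E {R : realType} (a b c d : R) :
  [/\ mx2 a b c d ord0 ord0 = a, mx2 a b c d ord0 ord_max = b,
      mx2 a b c d ord_max ord0 = c & mx2 a b c d ord_max ord_max = d].
Proof. by rewrite /mx2 !mxE. Qed.

Lemma sqnorm_mulmx_bounded {R : realType} (L : 'M[R]_2) :
  exists2 C, 0 < C & forall v, sqnorm (L *m v) <= C * sqnorm v.
Proof.
(* The summand 1 makes the constant positive also when [L = 0]. *)
exists (\sum_i \sum_j L i j ^+ 2 + 1).
  by rewrite ltr_wpDl// sumr_ge0// => i _; rewrite sumr_ge0// => j _; exact: sqr_ge0.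
move=> v; rewrite !sqnormE !mulmx2E !big_ord_recl !big_ord0 !addr0.
have -> : lift ord0 ord0 = ord_max :> 'I_2 by exact: val_inj.
set x := v _ _; set y := v _ _.
set a := L ord0 ord0; set b := L _ ord_max; set c := L _ ord0; set d := L _ _.
rewrite -subr_ge0; have -> : (a ^+ 2 + b ^+ 2 + (c ^+ 2 + d ^+ 2) + 1) *
   (x ^+ 2 + y ^+ 2) - ((a * x + b * y) ^+ 2 + (c * x + d * y) ^+ 2) =
   (a * y - b * x) ^+ 2 + (c * y - d * x) ^+ 2 + x ^+ 2 + y ^+ 2 by ring.
by rewrite !addr_ge0// sqr_ge0.
Qed.

(** * Singular values of matrices of determinant one *)

(** The sum of squares that shows it is produced by multiplying the form by its
trace; when the trace vanishes, so do all the coefficients. *)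
Lemma psd_form2 {R : realType} (p B r x y : R) :
  0 <= p + r -> B ^+ 2 <= p * r -> 0 <= p * x ^+ 2 - 2 * B * x * y + r * y ^+ 2.
Proof.
move=> tr0 Bpr; have [tr_gt0|tr_le0] := ltP 0 (p + r).
  rewrite -(pmulr_rge0 _ tr_gt0).
  have -> : (p + r) * (p * x ^+ 2 - 2 * B * x * y + r * y ^+ 2) =
    (p * x - B * y) ^+ 2 + (r * y - B * x) ^+ 2 +
    (p * r - B ^+ 2) * (x ^+ 2 + y ^+ 2) by ring.
  by rewrite !addr_ge0 ?sqr_ge0// mulr_ge0 ?subr_ge0// addr_ge0 ?sqr_ge0.
have rE : r = - p by lra.
have := sqr_ge0 B; have := sqr_ge0 p; rewrite rE in Bpr * => p2 B2.
have p0 : p = 0 by apply/eqP; rewrite -sqrf_eq0; apply/eqP; lra.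
have B0 : B = 0 by apply/eqP; rewrite -sqrf_eq0; apply/eqP; lra.
by rewrite p0 B0; lra.
Qed.

(** For a matrix [K] of determinant 1, the eigenvalues of [K^T K] are [g] and
[1/g], and their sum is the squared Frobenius norm of [K]; the larger one
bounds the growth of the squared length. In terms of forms, [g I - K^T K] has
determinant 0 and trace [g - 1/g], hence is positive semidefinite. *)
Lemma det1_singular_value {R : realType} (k11 k12 k21 k22 g x y : R) :
  1 <= g -> k11 * k22 - k12 * k21 = 1 ->
  k11 ^+ 2 + k12 ^+ 2 + k21 ^+ 2 + k22 ^+ 2 = g + g^-1 ->
  (k11 * x + k12 * y) ^+ 2 + (k21 * x + k22 * y) ^+ 2 <= g * (x ^+ 2 + y ^+ 2).
Proof.
move=> g1 det1 frob; have g0 : g != 0 by rewrite gt_eqF//; lra.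
have gV : g^-1 <= g by rewrite (le_trans _ g1)// invf_le1//; lra.
set p := g - (k11 ^+ 2 + k21 ^+ 2); set r := g - (k12 ^+ 2 + k22 ^+ 2).
set B := k11 * k12 + k21 * k22.
have pr : p * r - B ^+ 2 = 0.
  have -> : p * r - B ^+ 2 =
    g * (g - (k11 ^+ 2 + k12 ^+ 2 + k21 ^+ 2 + k22 ^+ 2)) +
    (k11 * k22 - k12 * k21) ^+ 2 by rewrite /p /r /B; ring.
  by rewrite frob det1; field.
have prB : B ^+ 2 <= p * r by lra.
have tr0 : 0 <= p + r by rewrite /p /r; lra.
have := psd_form2 p B r x y tr0 prB; rewrite -[in X in _ -> X]subr_ge0.
by congr (is_true (_ <= _)); rewrite /p /r /B; ring.
Qed.

(** * Monotonicity of the growth exponent *)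

Definition cosh {R : realType} (x : R) : R := (expR x + expR (- x)) / 2.

Lemma cosh_gt0 {R : realType} (x : R) : 0 < cosh x.
Proof. by rewrite divr_gt0// addr_gt0// expR_gt0. Qed.

Lemma cosh2 {R : realType} (x : R) : cosh x ^+ 2 = 1 + sinh x ^+ 2.
Proof.
have e1 : expR x * expR (- x) = 1 by rewrite -expRD subrr expR0.
by rewrite -[X in _ = X + _]e1 /sinh /cosh; field.
Qed.

Lemma sinhD {R : realType} (x y : R) :
  sinh (x + y) = sinh x * cosh y + cosh x * sinh y.
Proof. by rewrite /sinh /cosh opprD !expRD; field. Qed.

Lemma sinh0 {R : realType} : sinh (0 : R) = 0.
Proof. by rewrite /sinh oppr0 subrr mul0r. Qed.

Lemma ler_sinh {R : realType} : {mono @sinh R : x y / x <= y}.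
Proof.
apply: le_mono => x y xy; rewrite /sinh ltr_pM2r ?invr_gt0//.
by rewrite ltrB// ltr_expR// ltrN2.
Qed.

(** With [z = arsinh (k sinh x)] and [e = y - x], compare [sinh (z + e)] and
[k sinh (x + e)] by the addition formula: the terms in [cosh e] agree, and
[cosh z <= k cosh x] because [cosh z ^ 2 = 1 + k^2 sinh x ^ 2] and [1 <= k^2]. *)
Lemma arsinh_scaled_sinh_slope {R : realType} (k x y : R) : 1 <= k -> x <= y ->
  arsinh (k * sinh x) + (y - x) <= arsinh (k * sinh y).
Proof.
move=> k1 xy; rewrite -ler_sinh arsinhK.
have [e e0 ->] : exists2 e, 0 <= e & y = x + e by exists (y - x); [lra|ring].
rewrite [x + e - x]addrAC subrr add0r; set z := arsinh (k * sinh x).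
have k0 : 0 <= k by lra.
have sinh_e : 0 <= sinh e by rewrite -sinh0 ler_sinh.
rewrite !sinhD arsinhK mulrDr (mulrA k (sinh x)) (mulrA k (cosh x)) lerD2l ler_wpM2r//.
have coshx := ltW (cosh_gt0 x).
rewrite -(ler_pXn2r (n := 2))// ?nnegrE ?mulr_ge0// ?(ltW (cosh_gt0 z))//.
have k21 : 1 <= k ^+ 2 by rewrite expr_ge1.
by rewrite (exprMn 2 k (cosh x)) !cosh2 arsinhK (exprMn 2 k) mulrDr mulr1 lerD2r.
Qed.

(** For [p <= q] and [0 <= s] this is the logarithm of the Euclidean operator norm
of [M^-1 diag (expR (p s), expR (q s)) M], where [M] is any matrix of
determinant 1 whose rows have lengths of product [k]. *)
Definition growth_exponent {R : realType} (k p q s : R) : R :=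
  (q + p) / 2 * s + arsinh (k * sinh ((q - p) / 2 * s)).

(** The first summand has slope [(q + p) / 2], the second at least
[(q - p) / 2]. The exponent is therefore increasing as soon as [0 < q], even
when [q + p] is negative, and a stay shorter than the longest one allowed
brings a gain proportional to the time that is missing. *)
Lemma growth_exponent_slope {R : realType} (k p q s t : R) :
  1 <= k -> p <= q -> s <= t ->
  growth_exponent k p q s + q * (t - s) <= growth_exponent k p q t.
Proof.
move=> k1 pq st; have h0 : 0 <= (q - p) / 2 by lra.
have := arsinh_scaled_sinh_slope _ _ _ k1 (ler_wpM2l h0 st).
rewrite /growth_exponent; lra.
Qed.

Lemma growth_exponent0 {R : realType} (k p q : R) : growth_exponent k p q 0 = 0.
Proof.
have := sinhK (0 : R); rewrite sinh0 => arsinh0.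
by rewrite /growth_exponent !mulr0 sinh0 mulr0 add0r.
Qed.

Lemma growth_exponent_ge0 {R : realType} (k p q s : R) :
  1 <= k -> p <= q -> 0 <= q -> 0 <= s -> 0 <= growth_exponent k p q s.
Proof.
move=> k1 pq q0 s0; have := growth_exponent_slope k p q 0 s k1 pq s0.
by rewrite growth_exponent0 add0r subr0; apply: le_trans; rewrite mulr_ge0.
Qed.

Lemma le_growth_exponent {R : realType} (k p q s t : R) :
  1 <= k -> p <= q -> 0 <= q -> s <= t ->
  growth_exponent k p q s <= growth_exponent k p q t.
Proof.
move=> k1 pq q0 st; apply: le_trans (growth_exponent_slope k p q s t k1 pq st).
by rewrite lerDl mulr_ge0// subr_ge0.
Qed.

Lemma alpha_tau12 {R : realType} (al p q a b c d eta : R) : al != 0 ->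
  al * tau12 al p q a b c d eta =
  growth_exponent (Num.sqrt ((a ^+ 2 + b ^+ 2) * (c ^+ 2 + d ^+ 2))) p q eta.
Proof. by move=> al0; rewrite /tau12 /growth_exponent; field. Qed.

(** * Growth of a conjugated diagonal flow *)

(** Lagrange's identity: the product of the squared lengths of the two rows is
the squared determinant plus the squared scalar product. *)
Lemma conj_gain_ge1 {R : realType} (a b c d : R) : a * d - b * c = 1 ->
  1 <= Num.sqrt ((a ^+ 2 + b ^+ 2) * (c ^+ 2 + d ^+ 2)).
Proof.
move=> det1; rewrite -sqrtr1 ler_sqrt ?mulr_ge0 ?addr_ge0 ?sqr_ge0//.
have -> : (a ^+ 2 + b ^+ 2) * (c ^+ 2 + d ^+ 2) =
  (a * d - b * c) ^+ 2 + (a * c + b * d) ^+ 2 by ring.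
by rewrite det1 expr1n lerDl sqr_ge0.
Qed.

(** Once the scalar factor [expR ((q + p) / 2 * s)] is taken out, the conjugated
flow has determinant 1 and its squared Frobenius norm is
[2 + 4 k^2 sinh h ^ 2 = 2 cosh (2 Y)], where [h = (q - p) / 2 * s] and
[sinh Y = k sinh h]. So its largest singular value is [expR Y]. *)
Lemma diag_flow_conj_bound {R : realType} (a b c d p q s x y : R) :
  a * d - b * c = 1 -> p <= q -> 0 <= s ->
  (d * (expR (p * s) * (a * x + b * y)) -
   b * (expR (q * s) * (c * x + d * y))) ^+ 2 +
  (a * (expR (q * s) * (c * x + d * y)) -
   c * (expR (p * s) * (a * x + b * y))) ^+ 2 <=
  expR (2 * growth_exponent (Num.sqrt ((a ^+ 2 + b ^+ 2) * (c ^+ 2 + d ^+ 2))) p q s)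
  * (x ^+ 2 + y ^+ 2).
Proof.
move=> det1 pq s0; set k := Num.sqrt _.
set h := (q - p) / 2 * s; set m := (q + p) / 2 * s.
have h0 : 0 <= h by rewrite mulr_ge0//; lra.
set g := expR h; set E := expR m; set Y := arsinh (k * sinh h).
have g0 : 0 < g by exact: expR_gt0.
have gn0 : g != 0 by rewrite gt_eqF.
have gN : expR (- h) = g^-1 by rewrite expRN.
have -> : expR (p * s) = E * g^-1.
  by rewrite -gN -expRD; congr expR; rewrite /m /h; field.
have -> : expR (q * s) = E * g.
  by rewrite -expRD; congr expR; rewrite /m /h; field.
have -> : expR (2 * growth_exponent k p q s) = E ^+ 2 * expR (2 * Y).
  by rewrite /growth_exponent -/h -/m -/Y mulrDr expRD [2 * m]mulrC expRM_natr.
have k2 : k ^+ 2 = (a ^+ 2 + b ^+ 2) * (c ^+ 2 + d ^+ 2).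
  by rewrite sqr_sqrtr// mulr_ge0// addr_ge0// sqr_ge0.
have Y0 : 0 <= Y.
  by rewrite -ler_sinh sinh0 arsinhK mulr_ge0 ?sqrtr_ge0// -sinh0 ler_sinh.
have Y1 : 1 <= expR (2 * Y) by rewrite -expR0 ler_expR mulr_ge0.
have sumY : expR (2 * Y) + (expR (2 * Y))^-1 = 2 + k ^+ 2 * (g - g^-1) ^+ 2.
  have YN : expR Y * expR (- Y) = 1 by rewrite -expRD subrr expR0.
  have : sinh Y = k * sinh h by rewrite arsinhK.
  rewrite /sinh gN -/g => sY.
  have -> : k ^+ 2 * (g - g^-1) ^+ 2 = 4 * (k * ((g - g^-1) / 2)) ^+ 2 by field.
  rewrite -sY -expRN -mulrN ![2 * _]mulrC !expRM_natr.
  have -> : expR Y ^+ 2 + expR (- Y) ^+ 2 =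
    2 * (expR Y * expR (- Y)) + (expR Y - expR (- Y)) ^+ 2 by ring.
  by rewrite YN; field.
set k11 := a * d * g^-1 - b * c * g; set k12 := b * d * (g^-1 - g).
set k21 := a * c * (g - g^-1); set k22 := a * d * g - b * c * g^-1.
(* Both identities are homogeneous in [a, b, c, d] once 1 is replaced by the
   squared determinant, and then hold for all matrices. *)
have detK : k11 * k22 - k12 * k21 = 1.
  transitivity ((a * d - b * c) ^+ 2); last by rewrite det1 expr1n.
  by rewrite /k11 /k12 /k21 /k22; field.
have frob : k11 ^+ 2 + k12 ^+ 2 + k21 ^+ 2 + k22 ^+ 2 =
    expR (2 * Y) + (expR (2 * Y))^-1.
  rewrite sumY k2; transitivity (2 * (a * d - b * c) ^+ 2 +
    (a ^+ 2 + b ^+ 2) * (c ^+ 2 + d ^+ 2) * (g - g^-1) ^+ 2).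
    by rewrite /k11 /k12 /k21 /k22; field.
  by rewrite det1 expr1n mulr1.
have := ler_wpM2l (sqr_ge0 E) (det1_singular_value _ _ _ _ _ x y Y1 detK frob).
rewrite (mulrA (E ^+ 2)) => /(le_trans _); apply.
rewrite le_eqVlt; apply/orP; left; apply/eqP.
by rewrite /k11 /k12 /k21 /k22; ring.
Qed.

(** * Solutions in a single mode *)

(** The derivative of [expR (- l t) * f t] vanishes inside the interval. Only
continuity is available at the end points, which are switching times. *)
Lemma exponential_growth {R : realType} (f : R -> R) (l u v : R) : u <= v ->
  {within `[u, v], continuous f} ->
  (forall t, t \in `]u, v[ -> is_derive t 1 f (l * f t)) ->
  f v = expR (l * (v - u)) * f u.
Proof.
move=> uv cf df; pose g t := expR (- l * t) * f t.
have dE (t : R) : is_derive t 1 (fun s => expR (- l * s)) (- l * expR (- l * t)).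
  by apply: is_derive_eq; rewrite /GRing.scale/=; ring.
have [t _] : exists2 t, t \in `[u, v] & g v - g u = 0 * (v - u).
  apply: (@MVT_segment R g (fun=> 0)) => //.
    move=> t /df dft; apply: is_derive_eq; rewrite /GRing.scale/=; ring.
  move=> t; apply: cvgM; last exact: cf.
  move: t; apply: continuous_subspaceT => s.
  exact/differentiable_continuous/derivable1_diffP.
rewrite mul0r => /eqP; rewrite subr_eq0 /g => /eqP guv.
transitivity (expR (l * v) * (expR (- l * v) * f v)).
  by rewrite mulrA -expRD mulNr subrr expR0 mul1r.
by rewrite guv mulrA -expRD; congr (expR _ * _); ring.
Qed.

Definition solves {R : realType} (A : 'M[R]_2) (x : R -> 'cV[R]_2) (u v : R) :=
  {within `[u, v], continuous x} /\
  forall t, t \in `]u, v[ -> is_derive t 1 x (A *m x t).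

Lemma solves_prefix {R : realType} (A : 'M[R]_2) x (u t v : R) :
  t <= v -> solves A x u v -> solves A x u t.
Proof.
move=> tv [cx dx]; split=> [|s]; first exact/continuous_subspaceW/cx/subset_itvl.
rewrite in_itv/= => /andP[us st]; apply: dx.
by rewrite in_itv/= us (lt_le_trans st).
Qed.

Lemma is_derive_coord {R : realType} (x : R -> 'cV[R]_2) (t : R) dx i :
  is_derive t 1 x dx -> is_derive t 1 (fun s => x s i ord0) (dx i ord0).
Proof.
move=> [xt <-]; have xti := derivable_mxP x t 1.
apply: DeriveDef; first exact: (xti.1 xt).
by rewrite derive_mx// mxE.
Qed.

(** The coordinates given by [L] carry the equation with matrix [A] to the one
with matrix [B]. The statement is scalar, so that
[exponential_growth] applies to each coordinate. *)
Lemma solves_coord {R : realType} (A L B : 'M[R]_2) x (u v : R) i :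
  L *m A = B *m L -> solves A x u v ->
  {within `[u, v], continuous (fun t => (L *m x t) i ord0)} /\
  forall t, t \in `]u, v[ ->
    is_derive t 1 (fun t => (L *m x t) i ord0) ((B *m (L *m x t)) i ord0).
Proof.
move=> LA [cx dx]; split=> [t|t /dx dxt].
  have -> : (fun t => (L *m x t) i ord0) =
    (fun t => L i ord0 * x t ord0 ord0 + L i ord_max * x t ord_max ord0).
    by apply/funext => s; rewrite mulmx2E.
  have cxi j : {within `[u, v], continuous (fun t => x t j ord0)}.
    move=> s; apply: (@continuous_comp (subspace `[u, v]) 'cV[R]_2 R x
      (fun M => M j ord0) s); [exact: cx|exact: coord_continuous].
  by apply: cvgD; apply: cvgM; (exact: cvg_cst || exact: cxi).
have -> : (fun t => (L *m x t) i ord0) =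
    (fun t => L i ord0 * x t ord0 ord0 + L i ord_max * x t ord_max ord0).
  by apply/funext => s; rewrite mulmx2E.
have d0 := is_derive_coord _ _ _ ord0 dxt.
have d1 := is_derive_coord _ _ _ ord_max dxt.
apply: is_derive_eq; rewrite mulmxA -LA -mulmxA [RHS]mulmx2E.
by rewrite /GRing.scale/=; ring.
Qed.

(** In the coordinates of a focus the rotation is orthogonal to the radius, so
the squared length obeys a scalar linear equation. *)
Lemma focus_decay {R : realType} (P : 'M[R]_2) (al be : R) x (u v : R) :
  P \in unitmx -> u <= v ->
  solves (P *m mx2 (- al) be (- be) (- al) *m invmx P) x u v ->
  sqnorm (invmx P *m x v) = expR (- (2 * al) * (v - u)) * sqnorm (invmx P *m x u).
Proof.
set J := mx2 _ _ _ _ => Pu uv xs.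
have PA : invmx P *m (P *m J *m invmx P) = J *m invmx P.
  by rewrite !mulmxA mulVmx// mul1mx.
have [c0 d0] := solves_coord _ _ _ _ _ _ ord0 PA xs.
have [c1 d1] := solves_coord _ _ _ _ _ _ ord_max PA xs.
apply: (exponential_growth (fun t => sqnorm (invmx P *m x t))) => //.
  have -> : (fun t => sqnorm (invmx P *m x t)) = (fun t =>
      (invmx P *m x t) ord0 ord0 ^+ 2 + (invmx P *m x t) ord_max ord0 ^+ 2).
    by apply/funext => s; rewrite sqnormE.
  by move=> t; apply: cvgD; apply: cvgM; (exact: c0 || exact: c1).
move=> t tuv; have D0 := d0 t tuv; have D1 := d1 t tuv.
have -> : (fun t => sqnorm (invmx P *m x t)) = (fun t =>
    (invmx P *m x t) ord0 ord0 ^+ 2 + (invmx P *m x t) ord_max ord0 ^+ 2).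
  by apply/funext => s; rewrite sqnormE.
apply: is_derive_eq; rewrite sqnormE !(mulmx2E J) /J.
have [-> -> -> ->] := mx2E (- al) be (- be) (- al).
by rewrite /GRing.scale/=; ring.
Qed.

Lemma diag_flow {R : realType} (P : 'M[R]_2) (p q : R) x (u v : R) :
  P \in unitmx -> u <= v -> solves (P *m mx2 p 0 0 q *m invmx P) x u v ->
  (invmx P *m x v) ord0 ord0 = expR (p * (v - u)) * (invmx P *m x u) ord0 ord0 /\
  (invmx P *m x v) ord_max ord0 =
    expR (q * (v - u)) * (invmx P *m x u) ord_max ord0.
Proof.
set J := mx2 _ _ _ _ => Pu uv xs.
have PA : invmx P *m (P *m J *m invmx P) = J *m invmx P.
  by rewrite !mulmxA mulVmx// mul1mx.
have [c0 d0] := solves_coord _ _ _ _ _ _ ord0 PA xs.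
have [c1 d1] := solves_coord _ _ _ _ _ _ ord_max PA xs.
have [J00 J01 J10 J11] := mx2E p 0 0 q.
split.
- apply: (exponential_growth (fun t => (invmx P *m x t) ord0 ord0)) => // t /d0.
  by rewrite (mulmx2E J) J00 J01 mul0r addr0.
- apply: (exponential_growth (fun t => (invmx P *m x t) ord_max ord0)) => // t /d1.
  by rewrite (mulmx2E J) J10 J11 mul0r add0r.
Qed.

Lemma det_mx2 {R : realType} (a b c d : R) : \det (mx2 a b c d) = a * d - b * c.
Proof.
rewrite (expand_det_row _ ord0) !big_ord_recl big_ord0 /cofactor !det_mx11 !mxE /=.
by rewrite expr0 expr1; ring.
Qed.

(** The flow is diagonal in the coordinates of [P2], but the growth is measured in
those of [P1], which are adapted to the other mode. *)
Lemma node_growth {R : realType} (P1 P2 : 'M[R]_2) (a b c d p q : R) x (u v : R) :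
  P1 \in unitmx -> P2 \in unitmx -> invmx P2 *m P1 = mx2 a b c d ->
  a * d - b * c = 1 -> p <= q -> u <= v ->
  solves (P2 *m mx2 p 0 0 q *m invmx P2) x u v ->
  sqnorm (invmx P1 *m x v) <=
  expR (2 * growth_exponent (Num.sqrt ((a ^+ 2 + b ^+ 2) * (c ^+ 2 + d ^+ 2)))
              p q (v - u)) * sqnorm (invmx P1 *m x u).
Proof.
move=> uP1 uP2 M12 det1 pq uv xs.
have zE t : invmx P2 *m x t = mx2 a b c d *m (invmx P1 *m x t).
  by rewrite -M12 mulmxA mulmxK.
have [m00 m01 m10 m11] := mx2E a b c d.
have y0E t : (invmx P1 *m x t) ord0 ord0 =
    d * (invmx P2 *m x t) ord0 ord0 - b * (invmx P2 *m x t) ord_max ord0.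
  rewrite zE !(mulmx2E (mx2 _ _ _ _)) m00 m01 m10 m11.
  by rewrite -[LHS]mul1r -det1; ring.
have y1E t : (invmx P1 *m x t) ord_max ord0 =
    a * (invmx P2 *m x t) ord_max ord0 - c * (invmx P2 *m x t) ord0 ord0.
  rewrite zE !(mulmx2E (mx2 _ _ _ _)) m00 m01 m10 m11.
  by rewrite -[LHS]mul1r -det1; ring.
have [z0 z1] := diag_flow _ _ _ _ _ _ uP2 uv xs.
have uv0 : 0 <= v - u by rewrite subr_ge0.
have := diag_flow_conj_bound a b c d p q (v - u) ((invmx P1 *m x u) ord0 ord0)
  ((invmx P1 *m x u) ord_max ord0) det1 pq uv0.
rewrite -sqnormE; apply: le_trans; rewrite [leLHS]sqnormE (y0E v) (y1E v) z0 z1.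
by rewrite zE !(mulmx2E (mx2 _ _ _ _)) m00 m01 m10 m11.
Qed.

(** * Switching signals *)

Lemma switching_time_homo {R : realType} (sigma : R -> mode) d (m n : nat) :
  switching_signal sigma d -> (m <= n)%N -> d m <= d n.
Proof.
case=> -[_ dlt] _ _ _ _; move: m n.
apply: (@homo_leq _ d (fun a b => a <= b)) => // [b a c|k]; last exact: ltW.
exact: le_trans.
Qed.

Lemma switching_time_ge0 {R : realType} (sigma : R -> mode) d (k : nat) :
  switching_signal sigma d -> 0 <= d k.
Proof.
move=> sd; have := switching_time_homo _ _ 0 k sd (leq0n k).
by case: sd => -[->].
Qed.

Lemma signal_cst {R : realType} (sigma : R -> mode) d (k : nat) t :
  switching_signal sigma d -> d k <= t < d k.+1 -> sigma t = sigma (d k).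
Proof.
move=> sd /andP[dt td]; have dk0 := switching_time_ge0 _ _ k sd.
case: (sd) => -[_ dlt] _ rc cst _.
move: dt; rewrite le_eqVlt => /orP[/eqP->//|dt].
have : \forall u \near (d k)^'+, sigma u = sigma (d k) /\ d k < u < d k.+1.
  near=> u; split; first by near: u; exact: rc.
  apply/andP; split; first by near: u; exact: nbhs_right_gt.
  by near: u; exact: nbhs_right_lt.
move=> near_dk.
have [u [<- du]] := @filter_ex _ _ (at_right_proper_filter (d k)) _ near_dk.
apply: (cst k) => //.
by rewrite dt.
Unshelve. all: by end_near. Qed.

(** Otherwise the signal would be constant on the two adjacent intervals and at the
point between them, hence continuous at that point. *)
Lemma signal_flips {R : realType} (sigma : R -> mode) d (k : nat) :
  switching_signal sigma d -> sigma (d k.+1) <> sigma (d k).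
Proof.
move=> sd eqs; case: (sd) => -[_ dlt] _ _ _ /(_ k); apply.
near=> u.
have lu : d k < u by near: u; exact: lt_nbhsr (dlt k).
have ul : u < d k.+2 by near: u; exact: lt_nbhsl (dlt k.+1).
have [ud|du] := ltP u (d k.+1).
  by rewrite eqs; apply: (signal_cst sigma d k u sd); rewrite ud (ltW lu).
by apply: (signal_cst sigma d k.+1 u sd); rewrite du.
Unshelve. all: by end_near. Qed.

Lemma signal_alternates {R : realType} (sigma : R -> mode) d (k : nat) :
  switching_signal sigma d -> sigma 0 = Mode1 ->
  sigma (d (2 * k)%N) = Mode1 /\ sigma (d (2 * k).+1) = Mode2.
Proof.
move=> sd s0.
have flip j m m' : sigma (d j) = m -> m <> m' -> sigma (d j.+1) = m'.
  have := @signal_flips _ _ _ j sd.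
  by case: (sigma (d j)); case: (sigma (d j.+1)); case: m; case: m'.
have d0 : sigma (d 0%N) = Mode1 by case: sd => -[-> _].
elim: k => [|k [_ IH]]; first by rewrite muln0; split=> //; apply: flip d0 _.
have h1 : sigma (d (2 * k).+2) = Mode1 by apply: flip IH _.
by rewrite mulnS; split => //; apply: flip h1 _.
Qed.

Lemma trajectory_solves {R : realType} (A : mode -> 'M[R]_2) sigma d x (k : nat) m :
  switching_signal sigma d -> trajectory A sigma x -> sigma (d k) = m ->
  solves (A m) x (d k) (d k.+1).
Proof.
move=> sd [cx dx] <-; have dk0 := switching_time_ge0 _ _ k sd.
split.
  apply: continuous_subspaceW cx => t /=.
  by rewrite in_itv/= => /andP[/(le_trans dk0)].
move=> t; rewrite in_itv/= => /andP[dt td].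
have cst u : d k < u -> u < d k.+1 -> sigma u = sigma (d k).
  by move=> du ud; apply: (signal_cst sigma d k u sd); rewrite (ltW du).
rewrite -(cst t)//; apply: dx; first exact: le_lt_trans dt.
near=> u; rewrite (cst t)// cst//; near: u; [exact: lt_nbhsr|exact: lt_nbhsl].
Unshelve. all: by end_near. Qed.

(** The starting cycle [K] is arbitrary so that the bounds on whole cycles give
bounds on all later times, not only on all times. *)
Lemma cycle_cover {R : realType} (sigma : R -> mode) d (K : nat) t :
  switching_signal sigma d -> d (2 * K)%N <= t ->
  exists2 k, (K <= k)%N & d (2 * k)%N <= t < d (2 * k).+2.
Proof.
move=> sd Kt; case: (sd) => _ dy _ _ _.
have ex : exists n, (K <= n)%N && (t < d (2 * n)%N).
  have /cvgryPgt/(_ t)[N _ Nt] := dy.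
  exists (maxn K N); rewrite leq_maxl/=; apply: Nt => /=.
  by rewrite (leq_trans (leq_maxr K N))// leq_pmull.
case: (ex_minnP ex) => -[|n] /andP[Kn tn] nmin.
  by move: Kn; rewrite leqn0 => /eqP K0; subst K; rewrite ltNge Kt in tn.
move: Kn; rewrite leq_eqVlt => /orP[/eqP KE|]; first by rewrite -KE ltNge Kt in tn.
rewrite ltnS => Kn; exists n => //; rewrite -[(2 * n).+2]/(2 + 2 * n)%N -mulnS tn andbT.
by rewrite leNgt; apply/negP => tn'; have := nmin n; rewrite Kn tn' ltnn; move/(_ isT).
Qed.

(** * Contraction over a cycle *)

(** A nonincreasing nonnegative sequence converges. If its limit [l] were positive,
then [2 r k * l] would be at most the decrement [V k - V k.+1], and the
decrements tend to 0. *)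
Lemma vanishing_of_contraction {R : realType} (V r : nat -> R) :
  (forall k, 0 <= V k) -> (forall k, 0 <= r k) ->
  (forall k, V k.+1 <= expR (- (2 * r k)) * V k) ->
  ~ (r @ \oo --> 0) -> V @ \oo --> 0.
Proof.
move=> V0 r0 Vr nr.
have Vdec : {homo V : m n / (m <= n)%N >-> n <= m}.
  apply: (@homo_leq _ V (fun a b => b <= a)) => // [a b c ba cb|k].
    exact: le_trans cb ba.
  apply: (le_trans (Vr k)); rewrite ler_piMl// -expR0 ler_expR oppr_le0.
  by rewrite mulr_ge0.
have Vcvg : cvgn V by apply: nonincreasing_is_cvgn => //; exists 0 => _ [k _ <-].
set l := limn V.
have lV k : l <= V k by exact: nonincreasing_cvgn_ge.
have l0 : 0 <= l by apply: limr_ge => //; exact: nearW.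
have [l_gt0|] := ltP 0 l; last first.
  by move=> l_le0; have <- : l = 0 by apply/eqP; rewrite eq_le l_le0.
exfalso; apply: nr.
(* [1 + 2 r <= exp (2 r)] makes the decrements of [V] dominate [2 r l]. *)
have rV k : r k <= (V k - V k.+1) / (2 * l).
  rewrite ler_pdivlMr ?mulr_gt0//.
  have e1 : 1 + 2 * r k <= expR (2 * r k) by exact: expR_ge1Dx.
  have : (1 + 2 * r k) * V k.+1 <= V k.
    apply: (le_trans (ler_wpM2r (V0 _) e1)).
    apply: (le_trans (ler_wpM2l (expR_ge0 _) (Vr k))).
    by rewrite mulrA -expRD subrr expR0 mul1r.
  have := ler_wpM2l (r0 k) (lV k.+1); lra.
apply: (@squeeze_cvgr _ _ _ _ (fun=> 0) (fun k => (V k - V k.+1) / (2 * l))).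
- by apply: nearW => k; rewrite r0 rV.
- exact: cvg_cst.
- rewrite -(mul0r (2 * l)^-1) -(subrr l); apply: cvgM; last exact: cvg_cst.
  by apply: cvgB => //; rewrite cvg_shiftS.
Qed.

(** Over cycle [k] the length of [P1^-1 x] shrinks at least by the factor
[expR (- r)], where [r] is this number: the time in excess of [tau] in the
decaying mode counts at rate [al], the time short of [eta] in the other mode at
rate [q]. *)
Definition contraction_exponent {R : realType} (al q tau eta : R) (d : nat -> R) k :=
  al * (time_in1 d k - tau) + q * (eta - time_in2 d k).

Lemma contraction_exponent_cvg0 {R : realType} (al q tau eta : R) d :
  0 < al -> 0 < q ->
  (forall k, tau <= time_in1 d k /\ time_in2 d k <= eta) ->
  contraction_exponent al q tau eta d @ \oo --> 0 ->
  (fun k => (time_in1 d k, time_in2 d k)) @ \oo --> (tau, eta).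
Proof.
move=> al0 q0 dwell r0.
have rB k : 0 <= al * (time_in1 d k - tau) /\ 0 <= q * (eta - time_in2 d k).
  by have [t1 s1] := dwell k; rewrite !mulr_ge0 ?subr_ge0 ?(ltW al0) ?(ltW q0).
apply: (@cvg_pair _ _ _ \oo (nbhs tau) (nbhs eta) _ _ _ (time_in1 d) (time_in2 d)).
- apply: (@squeeze_cvgr _ _ _ _ (fun=> tau)
    (fun k => tau + contraction_exponent al q tau eta d k / al)).
  + apply: nearW => k; have [-> _] := dwell k; rewrite -lerBlDl ler_pdivlMr// mulrC.
    by rewrite lerDl; have [] := rB k.
  + exact: cvg_cst.
  + rewrite -[X in _ --> X]addr0 -(mul0r al^-1).
    by apply: cvgD; [exact: cvg_cst|apply: cvgM => //; exact: cvg_cst].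
- apply: (@squeeze_cvgr _ _ _ _
    (fun k => eta - contraction_exponent al q tau eta d k / q) (fun=> eta)).
  + apply: nearW => k; have [_ ->] := dwell k; rewrite andbT.
    rewrite lerBlDl -lerBlDr ler_pdivlMr// mulrC lerDr.
    by have [] := rB k.
  + rewrite -[X in _ --> X]subr0 -(mul0r q^-1).
    by apply: cvgB; [exact: cvg_cst|apply: cvgM => //; exact: cvg_cst].
  + exact: cvg_cst.
Qed.

(** At the critical dwell time the decay during [tau] balances exactly the growth
during [eta]; both the excess of a first stay over [tau] and the deficit of a
second stay below [eta] turn into contraction. *)
Lemma cycle_estimates {R : realType} (A1 A2 P1 P2 : 'M[R]_2)
    (al be p q a b c d eta : R) (sigma : R -> mode) (dt : nat -> R) x :
  P1 \in unitmx -> P2 \in unitmx -> 0 < al -> p <= q -> 0 <= q ->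
  A1 = P1 *m mx2 (- al) be (- be) (- al) *m invmx P1 ->
  A2 = P2 *m mx2 p 0 0 q *m invmx P2 ->
  invmx P2 *m P1 = mx2 a b c d -> a * d - b * c = 1 -> 0 < eta ->
  switching_signal sigma dt -> sigma 0 = Mode1 ->
  (forall k, tau12 al p q a b c d eta <= time_in1 dt k /\ time_in2 dt k <= eta) ->
  trajectory (switched A1 A2) sigma x ->
  let V t := sqnorm (invmx P1 *m x t) in
  (forall k t, dt (2 * k)%N <= t < dt (2 * k).+2 ->
    V t <= expR (2 * (al * tau12 al p q a b c d eta)) * V (dt (2 * k)%N)) /\
  (forall k, V (dt (2 * k).+2) <=
    expR (- (2 * contraction_exponent al q (tau12 al p q a b c d eta) eta dt k))
    * V (dt (2 * k)%N)).
Proof.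
move=> uP1 uP2 al0 pq q0 eA1 eA2 M12 det1 eta0 sd s0 dwell xtraj V.
have k1 := conj_gain_ge1 a b c d det1; set kap := Num.sqrt _ in k1.
set phi := growth_exponent kap p q; set tau := tau12 _ _ _ _ _ _ _ _.
have tauE : al * tau = phi eta by rewrite /tau alpha_tau12// gt_eqF.
rewrite tauE.
have [_ dlt] : dt 0%N = 0 /\ (forall k, dt k < dt k.+1) by case: sd.
have [s1 s2] : (forall k, solves A1 x (dt (2 * k)%N) (dt (2 * k).+1)) /\
               (forall k, solves A2 x (dt (2 * k).+1) (dt (2 * k).+2)).
  split=> k; have [m1 m2] := signal_alternates sigma dt k sd s0.
    exact: (trajectory_solves _ _ _ _ _ _ sd xtraj m1).
  exact: (trajectory_solves _ _ _ _ _ _ sd xtraj m2).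
have V0 t : 0 <= V t by exact: sqnorm_ge0.
have V1 k t : dt (2 * k)%N <= t <= dt (2 * k).+1 ->
    V t = expR (- (2 * al) * (t - dt (2 * k)%N)) * V (dt (2 * k)%N).
  move=> /andP[ut tv]; apply: (focus_decay P1 al be) => //.
  by rewrite -eA1; exact: solves_prefix (s1 k).
have V1le k t : dt (2 * k)%N <= t <= dt (2 * k).+1 -> V t <= V (dt (2 * k)%N).
  move=> tk; rewrite (V1 _ _ tk) ler_piMl// -expR0 ler_expR mulNr oppr_le0.
  by case/andP: tk => ? _; rewrite !mulr_ge0 ?subr_ge0 ?(ltW al0).
have V2 k t : dt (2 * k).+1 <= t <= dt (2 * k).+2 ->
    V t <= expR (2 * phi (t - dt (2 * k).+1)) * V (dt (2 * k).+1).
  move=> /andP[ut tv]; apply: (node_growth P1 P2 a b c d p q) => //.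
  by rewrite -eA2; exact: solves_prefix (s2 k).
split=> [k t /andP[ut tv]|k].
  have [tm|mt] := leP t (dt (2 * k).+1).
    apply: (le_trans (V1le k t _)); first by rewrite ut.
    by rewrite ler_peMl// -expR0 ler_expR mulr_ge0// growth_exponent_ge0// ltW.
  have phi_le : phi (t - dt (2 * k).+1) <= phi eta.
    apply: le_growth_exponent => //.
    by have [_] := dwell k; rewrite /time_in2; apply: le_trans; rewrite lerB// ltW.
  have Vmid : V (dt (2 * k).+1) <= V (dt (2 * k)%N).
    by apply: V1le; rewrite lexx andbT ltW.
  have tk : dt (2 * k).+1 <= t <= dt (2 * k).+2 by rewrite !ltW.
  apply: (le_trans (V2 k t tk)).
  apply: (le_trans (ler_wpM2l (expR_ge0 _) Vmid)).
  by apply: ler_wpM2r; [exact: V0|rewrite ler_expR; apply: ler_wpM2l].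
have mid_in : dt (2 * k)%N <= dt (2 * k).+1 <= dt (2 * k).+1.
  by rewrite lexx andbT ltW.
have end_in : dt (2 * k).+1 <= dt (2 * k).+2 <= dt (2 * k).+2.
  by rewrite lexx andbT ltW.
apply: (le_trans (V2 k _ end_in)); rewrite (V1 k _ mid_in) [leLHS]mulrA -expRD.
apply: ler_wpM2r; first exact: V0.
rewrite ler_expR -/(time_in1 dt k) -/(time_in2 dt k).
have := growth_exponent_slope kap p q (time_in2 dt k) eta k1 pq (dwell k).2.
by rewrite -/phi -tauE /contraction_exponent; lra.
Qed.

(** * From estimates over cycles to stability *)

Lemma enorm_lt {R : realType} (v : 'cV[R]_2) (e : R) :
  0 < e -> (enorm v < e) = (sqnorm v < e ^+ 2).
Proof.
move=> e0; rewrite -{1}[e]gtr0_norm// -sqrtr_sqr /enorm -/(sqnorm v).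
by rewrite ltr_sqrt// exprn_gt0.
Qed.

Lemma tail_bound {R : realType} (V : R -> R) (C : R) sigma d (K : nat) t :
  switching_signal sigma d -> 0 <= C ->
  (forall k s, d (2 * k)%N <= s < d (2 * k).+2 -> V s <= C * V (d (2 * k)%N)) ->
  (forall k, V (d (2 * k).+2) <= V (d (2 * k)%N)) ->
  d (2 * K)%N <= t -> V t <= C * V (d (2 * K)%N).
Proof.
move=> sd C0 Vcycle Vstep Kt; have [k Kk tk] := cycle_cover _ _ _ _ sd Kt.
apply: (le_trans (Vcycle k t tk)); rewrite ler_wpM2l//.
apply: (@homo_leq _ (fun k => V (d (2 * k)%N)) (fun a b => b <= a)) Kk => //.
  by move=> y x z yx zy; exact: le_trans zy yx.
by move=> j; rewrite mulnS; exact: Vstep.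
Qed.

(** Stability does not depend on the linear coordinates in which lengths are
measured: the distortion by [L] and by its inverse is absorbed in [delta]. *)
Lemma stable_of_growth_bound {R : realType} A (sigma : R -> mode)
    (L : 'M[R]_2) (C : R) :
  L \in unitmx -> 0 < C ->
  (forall x, trajectory A sigma x -> forall t : R, 0 <= t ->
    sqnorm (L *m x t) <= C * sqnorm (L *m x 0)) ->
  stable A sigma.
Proof.
move=> uL C0 bound e e0.
have [C1 C1_gt0 bL] := sqnorm_mulmx_bounded L.
have [C2 C2_gt0 bLV] := sqnorm_mulmx_bounded (invmx L).
have D0 : 0 < C2 * (C * C1) by rewrite !mulr_gt0.
exists (e / Num.sqrt (C2 * (C * C1))); first by rewrite divr_gt0// sqrtr_gt0.
move=> x xtraj; rewrite enorm_lt ?divr_gt0 ?sqrtr_gt0// => x0 t t0.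
rewrite enorm_lt//.
rewrite expr_div_n sqr_sqrtr ?ltW// ltr_pdivlMr// mulrC in x0.
apply: le_lt_trans x0; rewrite -{1}(mulKmx uL (x t)).
apply: (le_trans (bLV _)).
rewrite -!mulrA; apply: ler_wpM2l; first exact: ltW.
apply: (le_trans (bound x xtraj t (ltW t0))).
by apply: ler_wpM2l; [exact: ltW|exact: bL].
Qed.

Lemma enorm_cvg0 {R : realType} (x : R -> 'cV[R]_2) (L : 'M[R]_2) :
  L \in unitmx -> sqnorm (L *m x t) @[t --> +oo] --> 0 ->
  enorm (x t) @[t --> +oo] --> 0.
Proof.
move=> uL V0; apply/cvgr0Pnorm_lt => e e0.
have [C C0 bLV] := sqnorm_mulmx_bounded (invmx L).
have eC : 0 < e ^+ 2 / C by rewrite divr_gt0 ?exprn_gt0.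
move/cvgr0Pnorm_lt/(_ _ eC) : V0; apply: filterS => t.
rewrite ger0_norm ?sqnorm_ge0// ltr_pdivlMr// => Vt.
rewrite ger0_norm ?sqrtr_ge0// enorm_lt// -{1}(mulKmx uL (x t)).
by apply: le_lt_trans (bLV _) _; rewrite mulrC.
Qed.

Theorem theorem6p2 (R : realType) (A1 A2 P1 P2 : 'M[R]_2)
    (alpha1 beta1 p2 q2 a b c d eta : R)
    (hP1 : P1 \in unitmx) (hP2 : P2 \in unitmx)
    (halpha1 : 0 < alpha1) (hbeta1 : beta1 != 0)
    (hpq : (0 < p2 /\ p2 < q2) \/ (p2 <= 0 /\ 0 < q2))
    (hA1 : A1 = P1 *m mx2 (- alpha1) beta1 (- beta1) (- alpha1) *m invmx P1)
    (hA2 : A2 = P2 *m mx2 p2 0 0 q2 *m invmx P2)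
    (hM : invmx P2 *m P1 = mx2 a b c d)
    (hdet : \det (mx2 a b c d) = 1)
    (heta : 0 < eta) :
  (forall sigma : R -> mode,
     signal_class (tau12 alpha1 p2 q2 a b c d eta) eta sigma ->
     stable (switched A1 A2) sigma) /\
  (forall sigma : R -> mode,
     signal_class' (tau12 alpha1 p2 q2 a b c d eta) eta sigma ->
     asymptotically_stable (switched A1 A2) sigma).
Proof.
have q0 : 0 < q2 by case: hpq => -[? ?]; lra.
have pq : p2 <= q2 by case: hpq => -[? ?]; lra.
rewrite det_mx2 in hdet; set tau := tau12 _ _ _ _ _ _ _ _.
pose C := expR (2 * (alpha1 * tau)).
have C0 : 0 < C by exact: expR_gt0.
have uP : invmx P1 \in unitmx by rewrite unitmx_inv.
have r0 dt k : (forall k, tau <= time_in1 dt k /\ time_in2 dt k <= eta) ->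
    0 <= contraction_exponent alpha1 q2 tau eta dt k.
  by case/(_ k) => t1 s1; rewrite addr_ge0// mulr_ge0 ?subr_ge0// ltW.
have bounds sigma dt x K t : switching_signal sigma dt -> sigma 0 = Mode1 ->
    (forall k, tau <= time_in1 dt k /\ time_in2 dt k <= eta) ->
    trajectory (switched A1 A2) sigma x -> dt (2 * K)%N <= t ->
    sqnorm (invmx P1 *m x t) <= C * sqnorm (invmx P1 *m x (dt (2 * K)%N)).
  move=> sd s0 dwell xtraj.
  have [Vcycle Vstep] := cycle_estimates _ _ _ _ _ _ _ _ _ _ _ _ _ _ _ _ hP1 hP2
    halpha1 pq (ltW q0) hA1 hA2 hM hdet heta sd s0 dwell xtraj.
  apply: (tail_bound (fun t => sqnorm (invmx P1 *m x t)) C sigma dt K t sd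
    (ltW C0) Vcycle).
  move=> k; apply: (le_trans (Vstep k)); rewrite ler_piMl ?sqnorm_ge0//.
  by rewrite -expR0 ler_expR oppr_le0 mulr_ge0// r0.
have stab sigma : signal_class tau eta sigma -> stable (switched A1 A2) sigma.
  move=> [dt [sd s0 dwell]]; apply: (stable_of_growth_bound _ _ _ C uP C0).
  move=> x xtraj t t0; have d00 : dt 0%N = 0 by case: sd => -[].
  by have := bounds sigma dt x 0%N t sd s0 dwell xtraj; rewrite muln0 d00; apply.
split=> // sigma [dt [sd s0 dwell ncvg]]; split; first by apply: stab; exists dt.
move=> x xtraj; apply: (enorm_cvg0 _ _ uP).
have [_ Vstep] := cycle_estimates _ _ _ _ _ _ _ _ _ _ _ _ _ _ _ _ hP1 hP2
    halpha1 pq (ltW q0) hA1 hA2 hM hdet heta sd s0 dwell xtraj.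
have Vcvg : (fun k => sqnorm (invmx P1 *m x (dt (2 * k)%N))) @ \oo --> 0.
  apply: (vanishing_of_contraction _ (contraction_exponent alpha1 q2 tau eta dt)).
  - by move=> k; exact: sqnorm_ge0.
  - by move=> k; exact: r0.
  - by move=> k; rewrite mulnS; exact: Vstep.
  - by move=> /(contraction_exponent_cvg0 _ _ _ _ _ halpha1 q0 dwell).
apply/cvgr0Pnorm_lt => e e0; have eC : 0 < e / C by rewrite divr_gt0.
move/cvgr0Pnorm_lt/(_ _ eC) : Vcvg => [K _ /(_ K (leqnn K))] /=.
rewrite ger0_norm ?sqnorm_ge0// ltr_pdivlMr// mulrC => VK.
near=> t; rewrite ger0_norm ?sqnorm_ge0//.
apply: le_lt_trans VK; apply: (bounds sigma dt x K t sd s0 dwell xtraj).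
by near: t; apply: nbhs_pinfty_ge; exact: num_real.
Unshelve. all: by end_near. Qed.
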